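(* Let $N\ge1$, $h,l>0$, $\theta_1,\theta_2,\theta_3>0$, and let $\alpha,\beta\in\mathbb R$ with $\alpha\beta\ne0$. Let $T^{\mathrm{Rob}}$ and $T^{\mathrm{Neu}}$ be the transmission probabilities of the $N$-resonator system described in the context, with type-I vertex conditions (same $N,h,l,\theta$) and, respectively, the Robin condition with parameters $\alpha,\beta$ and the Neumann condition at all pendant vertices $u_j$. Let $\kappa_n=(2n-1)\pi/(2l)$, $n\in\mathbb N$, be the Neumann anti-resonances. Then for every $\rho>0$, $$\sup_{\substack{k\ge K\\ |k-\kappa_n|\ge\rho\ \forall n\in\mathbb N}}\bigl|T^{\mathrm{Rob}}(k)-T^{\mathrm{Neu}}(k)\bigr|\longrightarrow0\qquad\text{as }K\to\infty$$ (the supremum over the empty set being $0$).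
   Context: Model. The metric graph $G$ has vertices $v_1,\dots,v_N$ of degree 3, placed on the real line (the channel) at $x_j=(j-1)h$, and vertices $u_1,\dots,u_N$ of degree 1. The channel consists of the leads $e_{in}=(-\infty,0]$ (ending at $v_1$), $e_{out}=[(N-1)h,+\infty)$ (starting at $v_N$), and the segments of length $h$ between consecutive $v_j$'s. At each $v_j$ a resonator edge $(v_j,u_j)$ of length $l$ is attached, with coordinate $s\in[0,l]$, $s=0$ at $v_j$ and $s=l$ at $u_j$. At $v=v_j$, $\psi_1(v),\psi_2(v),\psi_3(v)$ denote the limits of $\psi$ at $v$ along the left channel edge, the right channel edge and the resonator edge, and $\psi_i'(v)$ the corresponding one-sided derivatives taken in the direction from $v$ into the edge. Type-I vertex conditions at every $v_j$: $\frac{\psi_1(v)}{\theta_1}=\frac{\psi_2(v)}{\theta_2}=\frac{\psi_3(v)}{\theta_3}$ and $\theta_1\psi_1'(v)+\theta_2\psi_2'(v)+\theta_3\psi_3'(v)=0$. Endpoint condition at each $u_j$, at $s=l$: Robin $\alpha\psi+\beta\frac{d\psi}{ds}=0$; Neumann $\frac{d\psi}{ds}=0$. Scattering solution at wavenumber $k>0$: a function $\psi$ on $G$ with $\psi''+k^2\psi=0$ on every edge, satisfying all vertex and endpoint conditions, with $\psi(x)=e^{ikx}+r(k)e^{-ikx}$ on $e_{in}$ and $\psi(x)=t(k)e^{ikx}$ on $e_{out}$. The amplitudes are uniquely determined; the transmission probability is $|t(k)|^2$. $\mathbb N=\{1,2,\dots\}$. *)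

(* Defs.v *)
From Stdlib Require Import Reals ClassicalEpsilon.
From Coquelicot Require Import Coquelicot.
Open Scope R_scope.

Definition expi (x : R) : C := (cos x, sin x).

Definition x_vertex (h : R) (j : nat) : R := (INR j - 1) * h.

(* [psi'' + k^2 psi = 0] on the open set [D] of reals, for complex-valued [psi];
   the derivatives are real derivatives of functions [R -> C]. *)
Definition helmholtz (k : R) (D : R -> Prop) (psi : R -> C) : Prop :=
  exists dpsi : R -> C, forall x : R, D x ->
    is_derive (V := C_R_NormedModule) psi x (dpsi x) /\
    is_derive (V := C_R_NormedModule) dpsi x (- (RtoC k * RtoC k * psi x))%C.

(* [f s] is the value of a wave function at distance [s] from an end of an edge.
   [z] is the limit at that end along the edge, and [d] the one-sided derivative
   there, in the direction from the end into the edge.  [f 0] is not used, since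
   a wave function may have different limits along the edges meeting at a
   vertex. *)
Definition trace (f : R -> C) (z d : C) : Prop :=
  filterlim f (at_right 0) (locally z) /\
  filterlim (fun s : R => ((f s - z) / RtoC s)%C) (at_right 0) (locally d).

Definition typeI (th1 th2 th3 : R) (z1 z2 z3 d1 d2 d3 : C) : Prop :=
  (z1 / RtoC th1 = z2 / RtoC th2)%C /\
  (z2 / RtoC th2 = z3 / RtoC th3)%C /\
  (RtoC th1 * d1 + RtoC th2 * d2 + RtoC th3 * d3 = RtoC 0)%C.

(* Endpoint conditions are relations between the value [z] and the derivative
   [d = d psi / ds] at [s = l]. *)
Definition robin (alpha beta : R) (z d : C) : Prop :=
  (RtoC alpha * z + RtoC beta * d = RtoC 0)%C.

Definition neumann (z d : C) : Prop := d = RtoC 0.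

(* A function on the graph is a function [psi] on the channel together with a
   function [chi j] of the coordinate [s] on the [j]-th resonator, 1 <= j <= N.
   The values of [psi] at the vertices and those of [chi j] at 0 and [l] are
   irrelevant: only limits along the edges enter. *)
Record scattering_solution (N : nat) (h l th1 th2 th3 : R)
    (endpoint : C -> C -> Prop) (k : R)
    (psi : R -> C) (chi : nat -> R -> C) (r t : C) : Prop := {
  channel_equation :
    helmholtz k
      (fun x => forall j : nat, (1 <= j <= N)%nat -> x <> x_vertex h j) psi;
  resonator_equation :
    forall j : nat, (1 <= j <= N)%nat ->
      helmholtz k (fun s => 0 < s < l) (chi j);
  vertex_condition :
    forall j : nat, (1 <= j <= N)%nat ->
      exists z1 z2 z3 d1 d2 d3 : C,
        trace (fun s => psi (x_vertex h j - s)) z1 d1 /\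
        trace (fun s => psi (x_vertex h j + s)) z2 d2 /\
        trace (chi j) z3 d3 /\
        typeI th1 th2 th3 z1 z2 z3 d1 d2 d3;
  (* The derivative into the edge at [u_j] is [- d psi / ds]. *)
  endpoint_condition :
    forall j : nat, (1 <= j <= N)%nat ->
      exists z d : C,
        trace (fun s => chi j (l - s)) z (- d)%C /\ endpoint z d;
  incoming_wave :
    forall x : R, x < 0 -> psi x = (expi (k * x) + r * expi (- (k * x)))%C;
  outgoing_wave :
    forall x : R, x_vertex h N < x -> psi x = (t * expi (k * x))%C
}.

(* For [k > 0] the amplitude [t] is uniquely determined, even when the
   scattering solution is not (a bound state may sit between two vertices), so
   the choice operator selects that value. *)
Definition transmission_amplitude (N : nat) (h l th1 th2 th3 : R)
    (endpoint : C -> C -> Prop) (k : R) : C :=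
  epsilon (inhabits (RtoC 0)) (fun t : C =>
    exists (psi : R -> C) (chi : nat -> R -> C) (r : C),
      scattering_solution N h l th1 th2 th3 endpoint k psi chi r t).

Definition transmission_probability (N : nat) (h l th1 th2 th3 : R)
    (endpoint : C -> C -> Prop) (k : R) : R :=
  (Cmod (transmission_amplitude N h l th1 th2 th3 endpoint k)) ^ 2.

Definition kappa (l : R) (n : nat) : R := (2 * INR n - 1) * PI / (2 * l).

Definition admissible (l rho K k : R) : Prop :=
  0 < k /\ K <= k /\
  forall n : nat, (1 <= n)%nat -> rho <= Rabs (k - kappa l n).

(* The values of the nonnegative [F] on [D], with 0 adjoined so that the least
   upper bound is 0 when [D] is empty and the supremum of [F] otherwise. *)
Definition values0 (D : R -> Prop) (F : R -> R) (y : R) : Prop :=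
  y = 0 \/ exists k : R, D k /\ y = F k.

(* Main.v *)
Require Import Defs.
From Stdlib Require Import Reals Lra Lia.
From Stdlib Require Import ClassicalEpsilon FunctionalExtensionality PropExtensionality.
From Coquelicot Require Import Coquelicot.
Open Scope R_scope.

(** The Neumann condition is the Robin condition with parameters [0] and [1],
    so everything is done for [robin a b] with [b <> 0].  The two conditions
    enter only through the impedance [m = chi'(0) / (k chi(0))] of a resonator:
    integrating [chi'' + k^2 chi = 0] from the far end gives
    [m = (b sin kl - (a/k) cos kl) / (b cos kl + (a/k) sin kl)], written
    [res_slope / res_value].  For [(a, b) = (0, 1)] this is [tan kl], with poles
    at the anti-resonances [kappa l n].  Away from them [cos kl] is bounded
    below (lemma [cos_away]), so for large [k] both impedances are bounded and differ by
    [O(1/k)] (lemma [impedance_close]).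

    It remains to see that the transmission probability is a Lipschitz function
    of [m], uniformly in [k].  On each channel segment [psi] is
    [Y cos kx + Q sin kx]; the same frame is used on all segments, so that
    [(Y, Q)] changes only at the vertices.  A type-I vertex together with its
    resonator multiplies the pair (value, derivative / k) by a real matrix of
    determinant 1, affine in [m] (lemma [typeI_transfer]).  Let [u] and [v] be
    the images of [(1,0)] and [(0,1)] after all [N] vertices; their Wronskian
    is 1, and matching the incoming wave [(1 + r, i (1 - r))] with the outgoing
    wave [(t, i t)] gives [2 = t ((u1 + v2) + i (u2 - v1))], hence
    [|t|^2 = 4 / (|u|^2 + |v|^2 + 2)] (lemma [probability_regular]).  The
    denominator is at least 2, and the entries of [u] and [v] are polynomials
    in [m] and in sines and cosines of real arguments, which gives the Lipschitz
    bound (lemma [transmittance_lipschitz]).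

    Since the amplitude is defined by a choice operator, both the uniqueness of
    [t] and the existence of a scattering solution are needed.  Solutions are
    glued from waves (lemma [glued_solution]).  The least upper bound must also
    exist when [K] is small, so the Robin poles [res_value = 0] count too; there
    [psi] vanishes at the vertices, the wave is totally reflected and [t = 0]
    (lemma [probability_pole]). *)

(** * One-sided traces *)

(** A trace sees a function only on a right neighbourhood of [0], without [0]. *)
Lemma trace_ext (f g : R -> C) (eps : R) (z d : C) :
  0 < eps -> (forall s, 0 < s < eps -> f s = g s) ->
  trace f z d -> trace g z d.
Proof.
  intros Heps Heq [H1 H2].
  assert (Hloc : forall P : R -> Prop,
             (forall s, 0 < s < eps -> P s) -> at_right 0 P).
  { intros P HP. exists (mkposreal eps Heps). intros y Hy Hy0. apply HP.
    change (Rabs (y - 0) < eps) in Hy.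
    rewrite Rabs_pos_eq in Hy; lra. }
  split.
  - apply filterlim_ext_loc with (2 := H1). apply Hloc. exact Heq.
  - apply filterlim_ext_loc with (2 := H2). apply Hloc.
    intros s Hs. now rewrite (Heq s Hs).
Qed.

Lemma trace_unique (f : R -> C) (z d z' d' : C) :
  trace f z d -> trace f z' d' -> z = z' /\ d = d'.
Proof.
  intros [H1 H2] [H1' H2'].
  assert (z = z').
  { exact (@filterlim_locally_unique R R_AbsRing C_R_NormedModule
             (at_right 0) (Proper_StrongProper _ (at_right_proper_filter 0)) f z z' H1 H1'). }
  subst z'. split; [reflexivity|].
  exact (@filterlim_locally_unique R R_AbsRing C_R_NormedModule
     (at_right 0) (Proper_StrongProper _ (at_right_proper_filter 0)) _ d d' H2 H2').
Qed.

Lemma norm_Cmod (z : C) : @norm R_AbsRing C_R_NormedModule z = Cmod z.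
Proof.
  unfold Cmod. rewrite <- (pow2_abs (fst z)), <- (pow2_abs (snd z)). reflexivity.
Qed.

Lemma trace_right (f : R -> C) (x : R) (d : C) :
  is_derive (V := C_R_NormedModule) f x d ->
  trace (fun s => f (x + s)) (f x) d.
Proof.
  intros Hd. split.
  - assert (Hc : continuous (U := C_R_NormedModule) f x).
    { apply ex_derive_continuous. now exists d. }
    unfold continuous in Hc.
    intros P HP. destruct (Hc P HP) as [e He]. exists e.
    intros y Hy _. apply He. change (Rabs (y - 0) < e) in Hy.
    change (Rabs (x + y - x) < e). now replace (x + y - x) with (y - 0) by ring.
  - apply (proj2 (@filterlim_locally_ball_norm R_AbsRing R C_R_NormedModule
                    (at_right 0) _ _ d)).
    intros eps.
    destruct Hd as [_ Hd].
    destruct (Hd x (fun P HP => HP) (pos_div_2 eps)) as [e He].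
    exists e. intros s Hs Hs0. change R in s. change (0 < s) in Hs0. change (Rabs (s - 0) < e) in Hs.
    specialize (He (x + s)).
    assert (Hb : ball x e (x + s)).
    { change (Rabs (x + s - x) < e). now replace (x + s - x) with (s - 0) by ring. }
    specialize (He Hb).
    change (@norm R_AbsRing C_R_NormedModule ((f (x + s)%R - f x) / RtoC s - d)%C < eps).
    rewrite norm_Cmod.
    assert (Hle : Cmod (f (x + s)%R - f x - RtoC s * d)%C <= eps / 2 * s).
    { refine (Rle_trans _ _ _ (Req_le _ _ _) (Rle_trans _ _ _ He (Req_le _ _ _))).
      - rewrite <- norm_Cmod. apply (f_equal (@norm R_AbsRing C_R_NormedModule)). apply injective_projections; cbn;
        unfold plus, opp, mult; simpl; ring.
      - cbn. unfold abs, plus, opp; simpl. replace (x + s + - x) with s by ring.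
        rewrite Rabs_pos_eq by (apply Rlt_le; exact Hs0). reflexivity. }
    replace ((f (x + s)%R - f x) / RtoC s - d)%C
      with (/ RtoC s * (f (x + s)%R - f x - RtoC s * d))%C.
    2:{ field. intros E. apply RtoC_inj in E. lra. }
    rewrite Cmod_mult, Cmod_inv, Cmod_R, Rabs_pos_eq.
    2:{ now apply Rlt_le. }
    2:{ intros E. apply RtoC_inj in E. lra. }
    apply Rle_lt_trans with (/ s * (eps / 2 * s)).
    + apply Rmult_le_compat_l; [|exact Hle]. left. now apply Rinv_0_lt_compat.
    + replace (/ s * (eps / 2 * s)) with (eps / 2) by (field; lra).
      destruct eps; simpl; lra.
Qed.

Lemma trace_left (f : R -> C) (x : R) (d : C) :
  is_derive (V := C_R_NormedModule) f x d ->
  trace (fun s => f (x - s)) (f x) (- d)%C.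
Proof.
  intros Hd.
  assert (H : is_derive (V := C_R_NormedModule) (fun y => f (- y)) (- x) (- d)%C).
  { replace (- d)%C with (@scal _ C_R_NormedModule (-1) d).
    2:{ apply injective_projections; cbn; unfold mult; simpl; ring. }
    apply (is_derive_comp (V := C_R_NormedModule) f (fun y => - y)).
    - now rewrite Ropp_involutive.
    - auto_derive; trivial; ring. }
  apply trace_right in H. rewrite Ropp_involutive in H.
  apply trace_ext with (3 := H) (eps := 1); [lra|].
  intros s _. f_equal. ring.
Qed.

(** * Waves on an edge *)

Definition wave (k : R) (Y Q : C) (x : R) : C :=
  (Y * RtoC (cos (k * x)) + Q * RtoC (sin (k * x)))%C.

Lemma wave_derive (k : R) (Y Q : C) (x : R) :
  is_derive (V := C_R_NormedModule) (wave k Y Q) x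
    (RtoC k * wave k Q (- Y) x)%C.
Proof.
  apply is_derive_ext with
    (f := fun x => @plus C_R_NormedModule (scal (cos (k * x)) Y) (scal (sin (k * x)) Q)).
  { intros t. apply injective_projections; cbn; unfold mult; simpl; ring. }
  replace (RtoC k * wave k Q (- Y) x)%C with
    (@plus C_R_NormedModule (scal (- k * sin (k * x)) Y) (scal (k * cos (k * x)) Q)).
  2:{ apply injective_projections; cbn; unfold mult, plus; simpl; ring. }
  apply @is_derive_plus; apply (@is_derive_scal_l R_AbsRing C_R_NormedModule);
    auto_derive; trivial; ring.
Qed.

Lemma wave_helmholtz (k : R) (Y Q : C) (x : R) :
  is_derive (V := C_R_NormedModule) (wave k Y Q) x (RtoC k * wave k Q (- Y) x)%C /\
  is_derive (V := C_R_NormedModule) (fun y => RtoC k * wave k Q (- Y) y)%C x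
    (- (RtoC k * RtoC k * wave k Y Q x))%C.
Proof.
  split; [apply wave_derive|].
  apply is_derive_ext with (f := wave k (RtoC k * Q) (RtoC k * - Y)%C).
  { intros t. match goal with |- ?a = ?b => change (@eq C a b) end. unfold wave. ring. }
  replace (- (RtoC k * RtoC k * wave k Y Q x))%C
    with (RtoC k * wave k (RtoC k * - Y) (- (RtoC k * Q)) x)%C
    by (unfold wave; ring).
  apply wave_derive.
Qed.

Lemma cos2_sin2_C (u : R) :
  (RtoC (cos u) * RtoC (cos u) + RtoC (sin u) * RtoC (sin u))%C = RtoC 1.
Proof.
  rewrite <- !RtoC_mult, <- RtoC_plus. f_equal.
  generalize (sin2_cos2 u). unfold Rsqr. lra.
Qed.

(** The map from [(Y, Q)] to (value, derivative / k) at [x] is the rotation of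
    angle [k x]; this is its inverse.  In particular a wave is determined by its
    value and derivative at one point. *)
Lemma wave_coefs (k : R) (Y Q : C) (x : R) :
  Y = (wave k Y Q x * RtoC (cos (k * x)) - wave k Q (- Y) x * RtoC (sin (k * x)))%C /\
  Q = (wave k Y Q x * RtoC (sin (k * x)) + wave k Q (- Y) x * RtoC (cos (k * x)))%C.
Proof.
  generalize (cos2_sin2_C (k * x)). intros E. unfold wave.
  split.
  - transitivity (Y * RtoC 1)%C; [ring|]. rewrite <- E. ring.
  - transitivity (Q * RtoC 1)%C; [ring|]. rewrite <- E. ring.
Qed.

Lemma wave_coefs_eq (k x : R) (Y Q Y' Q' : C) :
  wave k Y Q x = wave k Y' Q' x ->
  wave k Q (- Y) x = wave k Q' (- Y') x -> Y = Y' /\ Q = Q'.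
Proof.
  intros E1 E2. destruct (wave_coefs k Y Q x) as [HY HQ].
  destruct (wave_coefs k Y' Q' x) as [HY' HQ'].
  split; [rewrite HY, HY' | rewrite HQ, HQ']; now rewrite E1, E2.
Qed.

(** Variation of constants: the inverse rotation applied to [(psi, psi' / k)] has
    derivative [0], hence is constant on the interval [D].  The factor [k] is kept
    in [A] and [B] to avoid divisions. *)
Lemma helmholtz_wave (k : R) (D : R -> Prop) (psi : R -> C) (x0 : R) :
  0 < k -> D x0 ->
  (forall x y z, D x -> D y -> x <= z <= y -> D z) ->
  helmholtz k D psi ->
  exists Y Q : C, forall x, D x -> psi x = wave k Y Q x.
Proof.
  intros Hk H0 Hconv [dpsi H].
  assert (Hk' : RtoC k <> RtoC 0) by (intros E; apply RtoC_inj in E; lra).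
  pose (A := fun x => @plus C_R_NormedModule (scal (k * cos (k * x)) (psi x))
                        (scal (- sin (k * x)) (dpsi x))).
  pose (B := fun x => @plus C_R_NormedModule (scal (k * sin (k * x)) (psi x))
                        (scal (cos (k * x)) (dpsi x))).
  assert (Hprod : forall (a : R -> R) (f : R -> C) (x da : R) (df : C),
      is_derive a x da -> is_derive (V := C_R_NormedModule) f x df ->
      is_derive (V := C_R_NormedModule) (fun t => @scal _ C_R_NormedModule (a t) (f t)) x
        (@plus C_R_NormedModule (scal da (f x)) (scal (a x) df))).
  { intros a f x da df Ha Hf.
    unfold is_derive. eapply filterdiff_ext_lin.
    - apply (filterdiff_scal_fct (V := C_R_NormedModule) x a f _ _ Rmult_comm Ha Hf).
    - intros y. apply injective_projections; cbn; unfold mult, plus; simpl; ring. }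
  assert (HA : forall x, D x -> is_derive (V := C_R_NormedModule) A x zero).
  { intros x Hx. destruct (H x Hx) as [H1 H2].
    replace (@zero C_R_NormedModule) with
      (@plus C_R_NormedModule
        (@plus C_R_NormedModule (scal (- k * k * sin (k * x)) (psi x)) (scal (k * cos (k * x)) (dpsi x)))
        (@plus C_R_NormedModule (scal (- k * cos (k * x)) (dpsi x))
           (scal (- sin (k * x)) (- (RtoC k * RtoC k * psi x))%C))).
    2:{ apply injective_projections; cbn; unfold mult, plus; simpl; ring. }
    apply @is_derive_plus.
    - apply (Hprod (fun x => k * cos (k * x)) psi); [auto_derive; trivial; ring|exact H1].
    - apply (Hprod (fun x => - sin (k * x)) dpsi); [auto_derive; trivial; ring|exact H2]. }
  assert (HB : forall x, D x -> is_derive (V := C_R_NormedModule) B x zero).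
  { intros x Hx. destruct (H x Hx) as [H1 H2].
    replace (@zero C_R_NormedModule) with
      (@plus C_R_NormedModule
        (@plus C_R_NormedModule (scal (k * k * cos (k * x)) (psi x)) (scal (k * sin (k * x)) (dpsi x)))
        (@plus C_R_NormedModule (scal (- k * sin (k * x)) (dpsi x))
           (scal (cos (k * x)) (- (RtoC k * RtoC k * psi x))%C))).
    2:{ apply injective_projections; cbn; unfold mult, plus; simpl; ring. }
    apply @is_derive_plus.
    - apply (Hprod (fun x => k * sin (k * x)) psi); [auto_derive; trivial; ring|exact H1].
    - apply (Hprod (fun x => cos (k * x)) dpsi); [auto_derive; trivial; ring|exact H2]. }
  assert (Hcst : forall F : R -> C,
    (forall x, D x -> is_derive (V := C_R_NormedModule) F x zero) ->
    forall x, D x -> F x = F x0).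
  { intros F HF x Hx. destruct (total_order_T x x0) as [[L|E]|L].
    - apply (@eq_is_derive C_R_NormedModule); [|exact L].
      intros t Ht. apply HF. now apply (Hconv x x0).
    - now rewrite E.
    - symmetry. apply (@eq_is_derive C_R_NormedModule); [|exact L].
      intros t Ht. apply HF. now apply (Hconv x0 x). }
  exists (A x0 / RtoC k)%C, (B x0 / RtoC k)%C. intros x Hx.
  rewrite <- (Hcst A HA x Hx), <- (Hcst B HB x Hx).
  assert (EA : A x = (RtoC k * RtoC (cos (k * x)) * psi x - RtoC (sin (k * x)) * dpsi x)%C).
  { apply injective_projections; cbn; unfold mult, plus; simpl; ring. }
  assert (EB : B x = (RtoC k * RtoC (sin (k * x)) * psi x + RtoC (cos (k * x)) * dpsi x)%C).
  { apply injective_projections; cbn; unfold mult, plus; simpl; ring. }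
  rewrite EA, EB. unfold wave.
  transitivity (RtoC 1 * psi x)%C; [ring|]. rewrite <- (cos2_sin2_C (k * x)).
  field. exact Hk'.
Qed.

Lemma wave_trace_right (k : R) (Y Q : C) (x : R) :
  trace (fun s => wave k Y Q (x + s)) (wave k Y Q x) (RtoC k * wave k Q (- Y) x)%C.
Proof. apply trace_right, wave_derive. Qed.

Lemma wave_trace_left (k : R) (Y Q : C) (x : R) :
  trace (fun s => wave k Y Q (x - s)) (wave k Y Q x)
    (- (RtoC k * wave k Q (- Y) x))%C.
Proof. apply trace_left, wave_derive. Qed.

Lemma expi_wave (k x : R) (A B : C) :
  (A * expi (k * x) + B * expi (- (k * x)))%C = wave k (A + B) (Ci * (A - B)) x.
Proof.
  unfold wave, expi. rewrite cos_neg, sin_neg.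
  apply injective_projections; simpl; ring.
Qed.

(** * The resonator *)

(** The resonator function satisfying the endpoint condition is
    [b cos (k (l - s)) + (a/k) sin (k (l - s))]; these are its value and its
    derivative divided by [k] at [s = 0]. *)
Definition res_value (k l a b : R) : R := b * cos (k * l) + a / k * sin (k * l).
Definition res_slope (k l a b : R) : R := b * sin (k * l) - a / k * cos (k * l).

Lemma RtoC_neq (x : R) : x <> 0 -> RtoC x <> RtoC 0.
Proof. intros H E. now apply H, RtoC_inj. Qed.

(** The impedance relation [d = k m z], kept free of division so that it
    also covers [res_value = 0]. *)
Lemma resonator_relation (k l a b : R) (chi : R -> C) (z d z' d' : C) :
  0 < k -> 0 < l ->
  helmholtz k (fun s => 0 < s < l) chi ->
  trace chi z d -> trace (fun s => chi (l - s)) z' (- d')%C -> robin a b z' d' ->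
  (RtoC (res_value k l a b) * d = RtoC k * RtoC (res_slope k l a b) * z)%C.
Proof.
  intros Hk Hl Hh T0 Tl Hr.
  destruct (helmholtz_wave k (fun s => 0 < s < l) chi (l / 2) Hk ltac:(lra)
              ltac:(intros; lra) Hh) as [Y [Q HW]].
  assert (W0 : trace chi (wave k Y Q 0) (RtoC k * wave k Q (- Y) 0)%C).
  { apply trace_ext with (1 := Hl) (3 := wave_trace_right k Y Q 0).
    intros s Hs. rewrite Rplus_0_l. symmetry. now apply HW. }
  assert (Wl : trace (fun s => chi (l - s)) (wave k Y Q l) (- (RtoC k * wave k Q (- Y) l))%C).
  { apply trace_ext with (1 := Hl) (3 := wave_trace_left k Y Q l).
    intros s Hs. symmetry. apply HW. lra. }
  destruct (trace_unique _ _ _ _ _ T0 W0) as [E1 E2].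
  destruct (trace_unique _ _ _ _ _ Tl Wl) as [E3 E4].
  assert (E5 : d' = (RtoC k * wave k Q (- Y) l)%C).
  { transitivity (- - d')%C; [ring|]. rewrite E4. ring. }
  clear E4. unfold robin in Hr. rewrite E3, E5 in Hr. rewrite E1, E2.
  unfold wave in *. rewrite Rmult_0_r, cos_0, sin_0.
  unfold res_value, res_slope, Rdiv.
  rewrite RtoC_plus, RtoC_minus, !RtoC_mult, RtoC_inv by lra.
  assert (Hk' : RtoC k <> RtoC 0) by (apply RtoC_neq; lra).
  apply Ceq_minus. eapply eq_trans; [|exact Hr]. field. exact Hk'.
Qed.

(** * Transfer across the vertices *)

(** A real pair [v] stands for the wave [fst v cos kx + snd v sin kx]; [value]
    and [slope] are its value and its derivative divided by [k] at [x]. *)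
Definition value (k x : R) (v : R * R) : R :=
  fst v * cos (k * x) + snd v * sin (k * x).
Definition slope (k x : R) (v : R * R) : R :=
  snd v * cos (k * x) - fst v * sin (k * x).

(** Crossing a vertex at [x] with impedance [m]: the type-I conditions give the
    value [z] and slope [p] on the right, which are rotated back to coefficients
    of the wave. *)
Definition jump (th1 th2 th3 k m x : R) (v : R * R) : R * R :=
  let z := th2 / th1 * value k x v in
  let p := th1 / th2 * slope k x v - th3 ^ 2 / (th1 * th2) * m * value k x v in
  (z * cos (k * x) - p * sin (k * x), z * sin (k * x) + p * cos (k * x)).

(** Coefficients on the right of the [n]-th vertex of the real solution with
    coefficients [v] on the incoming lead. *)
Fixpoint coefs (h th1 th2 th3 k m : R) (n : nat) (v : R * R) : R * R :=
  match n with
  | O => v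
  | S n' => jump th1 th2 th3 k m (x_vertex h n) (coefs h th1 th2 th3 k m n' v)
  end.

Lemma cos2_sin2 (u : R) : cos u * cos u + sin u * sin u = 1.
Proof. generalize (sin2_cos2 u). unfold Rsqr. lra. Qed.

Lemma value_jump (th1 th2 th3 k m x : R) (v : R * R) :
  value k x (jump th1 th2 th3 k m x v) = th2 / th1 * value k x v.
Proof.
  unfold jump. set (z := th2 / th1 * _). set (p := th1 / th2 * _ - _).
  unfold value. simpl. transitivity (z * 1); [|ring].
  rewrite <- (cos2_sin2 (k * x)). ring.
Qed.

Lemma slope_jump (th1 th2 th3 k m x : R) (v : R * R) :
  slope k x (jump th1 th2 th3 k m x v) =
  th1 / th2 * slope k x v - th3 ^ 2 / (th1 * th2) * m * value k x v.
Proof.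
  unfold jump. set (z := th2 / th1 * _). set (p := th1 / th2 * _ - _).
  unfold slope. simpl. transitivity (p * 1); [|ring].
  rewrite <- (cos2_sin2 (k * x)). ring.
Qed.

Definition wronskian (u v : R * R) : R := fst u * snd v - snd u * fst v.

(** The Wronskian may be computed at any point, rotations having determinant 1. *)
Lemma wronskian_at (k x : R) (u v : R * R) :
  wronskian u v = value k x u * slope k x v - slope k x u * value k x v.
Proof.
  unfold wronskian, value, slope.
  transitivity ((fst u * snd v - snd u * fst v) * 1); [ring|].
  rewrite <- (cos2_sin2 (k * x)). ring.
Qed.

(** A vertex acts on (value, slope) by a triangular matrix with diagonal
    [th2 / th1], [th1 / th2], of determinant 1. *)
Lemma wronskian_coefs (h th1 th2 th3 k m : R) (n : nat) (u v : R * R) :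
  0 < th1 -> 0 < th2 ->
  wronskian (coefs h th1 th2 th3 k m n u) (coefs h th1 th2 th3 k m n v) =
  wronskian u v.
Proof.
  intros H1 H2. induction n as [|n IH]; [reflexivity|].
  rewrite <- IH. simpl coefs. rewrite !(wronskian_at k (x_vertex h (S n))).
  rewrite !value_jump, !slope_jump. field. lra.
Qed.

(** Coefficients of the complex wave [A u + B v]. *)
Definition mix (A B : C) (u v : R * R) : C * C :=
  ((A * RtoC (fst u) + B * RtoC (fst v))%C, (A * RtoC (snd u) + B * RtoC (snd v))%C).

Definition wave_of (k : R) (c : C * C) : R -> C := wave k (fst c) (snd c).
(** Derivative of the wave divided by [k]: [(Y cos + Q sin)' = k (Q cos - Y sin)]. *)
Definition slope_of (k : R) (c : C * C) : R -> C := wave k (snd c) (- fst c)%C.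

Lemma wave_mix (k x : R) (A B : C) (u v : R * R) :
  wave_of k (mix A B u v) x = (A * RtoC (value k x u) + B * RtoC (value k x v))%C.
Proof.
  unfold wave_of, wave, mix, value; simpl. rewrite !RtoC_plus, !RtoC_mult. ring.
Qed.

Lemma slope_mix (k x : R) (A B : C) (u v : R * R) :
  slope_of k (mix A B u v) x = (A * RtoC (slope k x u) + B * RtoC (slope k x v))%C.
Proof.
  unfold slope_of, wave, mix, slope; simpl. rewrite !RtoC_minus, !RtoC_mult. ring.
Qed.

Lemma wave_mix_jump (th1 th2 th3 k m x : R) (A B : C) (u v : R * R) :
  let J := jump th1 th2 th3 k m x in
  wave_of k (mix A B (J u) (J v)) x = (RtoC (th2 / th1) * wave_of k (mix A B u v) x)%C.
Proof.
  intros J. unfold J. rewrite !wave_mix, !value_jump, !RtoC_mult. ring.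
Qed.

Lemma slope_mix_jump (th1 th2 th3 k m x : R) (A B : C) (u v : R * R) :
  let J := jump th1 th2 th3 k m x in
  slope_of k (mix A B (J u) (J v)) x =
  (RtoC (th1 / th2) * slope_of k (mix A B u v) x -
   RtoC (th3 ^ 2 / (th1 * th2) * m) * wave_of k (mix A B u v) x)%C.
Proof.
  intros J. unfold J. rewrite !slope_mix, !wave_mix, !slope_jump.
  rewrite !RtoC_minus, !RtoC_mult. ring.
Qed.

(** Eliminating the resonator from the type-I conditions: it contributes
    [- th3^2 / (th1 th2) * m * z1] to the jump of derivative / k.  The minus sign
    in the hypothesis is there because derivatives point into the edges, so on
    the left edge they are opposite to the derivative along the channel. *)
Lemma typeI_transfer (th1 th2 th3 k D E : R) (z1 z2 z3 p1 d2 d3 : C) :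
  0 < th1 -> 0 < th2 -> 0 < th3 -> D <> 0 ->
  typeI th1 th2 th3 z1 z2 z3 (- (RtoC k * p1))%C d2 d3 ->
  (RtoC D * d3 = RtoC k * RtoC E * z3)%C ->
  z2 = (RtoC (th2 / th1) * z1)%C /\
  d2 = (RtoC k * (RtoC (th1 / th2) * p1 - RtoC (th3 ^ 2 / (th1 * th2) * (E / D)) * z1))%C.
Proof.
  intros H1 H2 H3 HD (E1 & E2 & E3) Hd.
  assert (C1 : RtoC th1 <> RtoC 0) by (apply RtoC_neq; lra).
  assert (C2 : RtoC th2 <> RtoC 0) by (apply RtoC_neq; lra).
  assert (C3 : RtoC th3 <> RtoC 0) by (apply RtoC_neq; lra).
  assert (CD : RtoC D <> RtoC 0) by (apply RtoC_neq; lra).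
  assert (Z2 : z2 = (RtoC th2 * (z1 / RtoC th1))%C) by (rewrite E1; field; auto).
  assert (Z3 : z3 = (RtoC th3 * (z1 / RtoC th1))%C) by (rewrite E1, E2; field; auto).
  assert (D3 : d3 = (RtoC k * RtoC E * z3 / RtoC D)%C) by (rewrite <- Hd; field; auto).
  assert (D2 : d2 = (- (RtoC th1 * - (RtoC k * p1) + RtoC th3 * d3) / RtoC th2)%C).
  { transitivity ((RtoC th1 * - (RtoC k * p1) + RtoC th2 * d2 + RtoC th3 * d3 -
      (RtoC th1 * - (RtoC k * p1) + RtoC th3 * d3)) / RtoC th2)%C; [field; auto|].
    rewrite E3. field; auto. }
  assert (Hn : th1 * th2 <> 0) by nra.
  unfold Rdiv. simpl pow. rewrite !RtoC_mult, !RtoC_inv by lra. rewrite !RtoC_mult.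
  split.
  - rewrite Z2. field; auto.
  - rewrite D2, D3, Z3. field; auto.
Qed.

Lemma typeI_pole (th1 th2 th3 : R) (z1 z2 d1 d2 d3 : C) :
  0 < th2 -> 0 < th3 -> typeI th1 th2 th3 z1 z2 (RtoC 0) d1 d2 d3 -> z2 = RtoC 0.
Proof.
  intros H2 H3 (_ & E2 & _).
  transitivity (RtoC th2 * (z2 / RtoC th2))%C; [field; apply RtoC_neq; lra|].
  rewrite E2. field. apply RtoC_neq; lra.
Qed.

(** * The channel and the amplitude *)

Lemma x_vertex_S (h : R) (j : nat) : x_vertex h (S j) = x_vertex h j + h.
Proof. unfold x_vertex. rewrite S_INR. ring. Qed.

Lemma x_vertex_1 (h : R) : x_vertex h 1 = 0.
Proof. unfold x_vertex. simpl. ring. Qed.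

Lemma x_vertex_le (h : R) (i j : nat) :
  0 < h -> (i <= j)%nat -> x_vertex h i <= x_vertex h j.
Proof.
  intros Hh Hij. unfold x_vertex. apply le_INR in Hij.
  apply Rmult_le_compat_r; lra.
Qed.

(** Segment [0] is the incoming lead and segment [N] the outgoing one; segment
    [j] lies between vertices [j] and [S j]. *)
Definition segment (N : nat) (h : R) (j : nat) (x : R) : Prop :=
  ((1 <= j)%nat -> x_vertex h j < x) /\ ((j < N)%nat -> x < x_vertex h (S j)).

(** Cramer's rule for [t]: the Wronskian is the determinant of the system. *)
Lemma mix_outgoing (u v : R * R) (A B t : C) :
  wronskian u v = 1 ->
  mix A (Ci * B) u v = (t, Ci * t)%C <->
  (A = t * (snd v, - fst v)%R)%C /\ (B = t * (fst u, snd u))%C.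
Proof.
  intros HW. unfold wronskian in HW. unfold mix.
  assert (HC : (RtoC (fst u) * RtoC (snd v) - RtoC (snd u) * RtoC (fst v) = RtoC 1)%C).
  { rewrite <- !RtoC_mult, <- RtoC_minus. now rewrite HW. }
  assert (Hi : (Ci * Ci = - RtoC 1)%C) by (apply injective_projections; simpl; ring).
  replace ((snd v, - fst v)%R : C) with (RtoC (snd v) - Ci * RtoC (fst v))%C
    by (apply injective_projections; simpl; ring).
  replace ((fst u, snd u) : C) with (RtoC (fst u) + Ci * RtoC (snd u))%C
    by (apply injective_projections; simpl; ring).
  split.
  - intros E.
    assert (E1 : (A * RtoC (fst u) + Ci * B * RtoC (fst v))%C = t)
      by exact (f_equal fst E).
    assert (E2 : (A * RtoC (snd u) + Ci * B * RtoC (snd v) = Ci * t)%C)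
      by exact (f_equal snd E).
    split.
    + transitivity (A * RtoC 1)%C; [ring|]. rewrite <- HC.
      transitivity (t * RtoC (snd v) - Ci * t * RtoC (fst v))%C; [|ring].
      rewrite <- E2. rewrite <- E1 at 1. ring.
    + transitivity (- (Ci * Ci) * B * RtoC 1)%C; [rewrite Hi; ring|]. rewrite <- HC.
      transitivity (- (Ci * (Ci * t)) * RtoC (fst u) + Ci * (t * RtoC (snd u)))%C.
      2:{ transitivity (- (Ci * Ci) * t * RtoC (fst u) + Ci * t * RtoC (snd u))%C; [ring|].
          rewrite Hi. ring. }
      rewrite <- E2. rewrite <- E1 at 1. ring.
  - intros [A1 A2]. rewrite A1, A2. f_equal.
    + transitivity (t * (RtoC (fst u) * RtoC (snd v) + Ci * Ci * RtoC (snd u) * RtoC (fst v)))%C;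
        [ring|].
      rewrite Hi. transitivity (t * (RtoC (fst u) * RtoC (snd v) - RtoC (snd u) * RtoC (fst v)))%C; [ring|]. rewrite HC. ring.
    + transitivity (Ci * t * (RtoC (fst u) * RtoC (snd v) - RtoC (snd u) * RtoC (fst v))
                    + (RtoC 1 + Ci * Ci) * t * RtoC (snd u) * RtoC (snd v))%C; [ring|].
      rewrite Hi, HC. ring.
Qed.

Lemma RtoC_mult_reg_l (x : R) (z w : C) :
  x <> 0 -> (RtoC x * z = RtoC x * w)%C -> z = w.
Proof.
  intros Hx E. apply RtoC_neq in Hx.
  transitivity (RtoC x * z / RtoC x)%C; [|rewrite E]; field; exact Hx.
Qed.

Section Amplitude.
Context (N : nat) (h l th1 th2 th3 a b k : R)
  (psi : R -> C) (chi : nat -> R -> C) (r t : C)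
  (HN : (1 <= N)%nat) (Hh : 0 < h) (Hl : 0 < l)
  (H1 : 0 < th1) (H2 : 0 < th2) (H3 : 0 < th3) (Hk : 0 < k)
  (Hsol : scattering_solution N h l th1 th2 th3 (robin a b) k psi chi r t).

Lemma segment_wave (j : nat) :
  (j <= N)%nat -> exists c : C * C, forall x, segment N h j x -> psi x = wave_of k c x.
Proof.
  intros Hj.
  (* A point of the segment; the incoming lead ends at [x_vertex h 1 = 0]. *)
  destruct (helmholtz_wave k (segment N h j) psi
     (if Nat.eq_dec j 0 then -1 else x_vertex h j + h / 2) Hk) as (Y & Q & HW).
  - destruct Nat.eq_dec as [->|Hj0]; split; intros Hj'.
    + lia.
    + rewrite x_vertex_1. lra.
    + lra.
    + rewrite x_vertex_S. lra.
  - intros x y z [Hx1 Hx2] [Hy1 Hy2] Hz.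
    split; intros Hj'; [specialize (Hx1 Hj') | specialize (Hy2 Hj')]; lra.
  - destruct (channel_equation _ _ _ _ _ _ _ _ _ _ _ _ Hsol) as [dpsi Hd].
    exists dpsi. intros x [Hx1 Hx2]. apply Hd. intros i Hi.
    destruct (Compare_dec.le_lt_dec i j) as [L|L].
    + specialize (Hx1 ltac:(lia)). generalize (x_vertex_le h i j Hh L). lra.
    + specialize (Hx2 ltac:(lia)). generalize (x_vertex_le h (S j) i Hh L). lra.
  - exists (Y, Q). exact HW.
Qed.

Lemma vertex_left (j : nat) (c : C * C) (z d : C) :
  (j < N)%nat -> (forall x, segment N h j x -> psi x = wave_of k c x) ->
  trace (fun s => psi (x_vertex h (S j) - s)) z d ->
  z = wave_of k c (x_vertex h (S j)) /\
  d = (- (RtoC k * slope_of k c (x_vertex h (S j))))%C.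
Proof.
  intros Hj Hc Ht.
  apply (trace_unique _ _ _ _ _ Ht).
  apply trace_ext with (1 := Hh) (3 := wave_trace_left k (fst c) (snd c) (x_vertex h (S j))).
  intros s Hs. symmetry. apply Hc. split; intros _; rewrite ?x_vertex_S; lra.
Qed.

Lemma vertex_right (j : nat) (c : C * C) (z d : C) :
  (1 <= j <= N)%nat -> (forall x, segment N h j x -> psi x = wave_of k c x) ->
  trace (fun s => psi (x_vertex h j + s)) z d ->
  z = wave_of k c (x_vertex h j) /\
  d = (RtoC k * slope_of k c (x_vertex h j))%C.
Proof.
  intros Hj Hc Ht.
  apply (trace_unique _ _ _ _ _ Ht).
  apply trace_ext with (1 := Hh) (3 := wave_trace_right k (fst c) (snd c) (x_vertex h j)).
  intros s Hs. symmetry. apply Hc. split; intros _; rewrite ?x_vertex_S; lra.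
Qed.

Lemma incoming_coefs (x : R) :
  segment N h 0 x -> psi x = wave_of k (1 + r, Ci * (1 - r))%C x.
Proof.
  intros [_ Hx]. specialize (Hx ltac:(lia)). rewrite x_vertex_1 in Hx.
  rewrite (incoming_wave _ _ _ _ _ _ _ _ _ _ _ _ Hsol x Hx).
  unfold wave_of; simpl. rewrite <- expi_wave. ring.
Qed.

Lemma outgoing_coefs (x : R) :
  segment N h N x -> psi x = wave_of k (t, Ci * t)%C x.
Proof.
  intros [Hx _]. specialize (Hx ltac:(lia)).
  rewrite (outgoing_wave _ _ _ _ _ _ _ _ _ _ _ _ Hsol x Hx).
  unfold wave_of; simpl.
  transitivity (t * expi (k * x) + 0 * expi (- (k * x)))%C; [ring|].
  rewrite expi_wave. f_equal; ring.
Qed.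

Lemma vertex_resonator (j : nat) :
  (1 <= j <= N)%nat ->
  exists z1 z2 z3 d1 d2 d3 : C,
    trace (fun s => psi (x_vertex h j - s)) z1 d1 /\
    trace (fun s => psi (x_vertex h j + s)) z2 d2 /\
    typeI th1 th2 th3 z1 z2 z3 d1 d2 d3 /\
    (RtoC (res_value k l a b) * d3 = RtoC k * RtoC (res_slope k l a b) * z3)%C.
Proof.
  intros Hj.
  destruct (vertex_condition _ _ _ _ _ _ _ _ _ _ _ _ Hsol j Hj)
    as (z1 & z2 & z3 & d1 & d2 & d3 & T1 & T2 & T3 & HI).
  exists z1, z2, z3, d1, d2, d3.
  split; [exact T1|]. split; [exact T2|]. split; [exact HI|].
  destruct (endpoint_condition _ _ _ _ _ _ _ _ _ _ _ _ Hsol j Hj) as (z & d & T & He).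
  apply (resonator_relation k l a b (chi j) z3 d3 z d); auto.
  apply (resonator_equation _ _ _ _ _ _ _ _ _ _ _ _ Hsol j Hj).
Qed.

(** By induction on the segment: the wave on the left of a vertex fixes its left
    value and derivative, the vertex conditions fix the right ones, and these
    determine the wave on the right. *)
Lemma transfer (j : nat) :
  res_value k l a b <> 0 ->
  let m := res_slope k l a b / res_value k l a b in
  (j <= N)%nat -> forall x, segment N h j x ->
  psi x = wave_of k (mix (1 + r) (Ci * (1 - r))
            (coefs h th1 th2 th3 k m j (1, 0)) (coefs h th1 th2 th3 k m j (0, 1)))%C x.
Proof.
  intros HD m. induction j as [|j IH]; intros Hj.
  - intros x Hx. rewrite (incoming_coefs x Hx). unfold wave_of, mix; simpl. f_equal; ring.
  - set (c := mix _ _ _ _). specialize (IH ltac:(lia)). set (c0 := mix _ _ _ _) in IH.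
    destruct (segment_wave (S j) Hj) as [c' Hc'].
    destruct (vertex_resonator (S j) ltac:(lia))
      as (z1 & z2 & z3 & d1 & d2 & d3 & T1 & T2 & HI & HR).
    destruct (vertex_left j c0 z1 d1 ltac:(lia) IH T1) as [-> ->].
    destruct (vertex_right (S j) c' z2 d2 ltac:(lia) Hc' T2) as [E2 E3].
    destruct (typeI_transfer _ _ _ _ _ _ _ _ _ _ _ _ H1 H2 H3 HD HI HR) as [F2 F3].
    fold m in F3. rewrite E2 in F2. rewrite E3 in F3.
    unfold c0 in F2, F3. rewrite <- wave_mix_jump with (th3 := th3) (m := m) in F2.
    rewrite <- slope_mix_jump in F3.
    change (wave_of k c' (x_vertex h (S j)) = wave_of k c (x_vertex h (S j))) in F2.
    change (RtoC k * slope_of k c' (x_vertex h (S j)) = RtoC k * slope_of k c (x_vertex h (S j)))%C in F3.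
    apply RtoC_mult_reg_l in F3; [|lra].
    destruct (wave_coefs_eq _ _ _ _ _ _ F2 F3) as [G1 G2].
    intros x Hx. rewrite (Hc' x Hx). unfold wave_of. now rewrite G1, G2.
Qed.

(** The two matching equations added together, which eliminates [r]. *)
Lemma amplitude_regular :
  res_value k l a b <> 0 ->
  let m := res_slope k l a b / res_value k l a b in
  let u := coefs h th1 th2 th3 k m N (1, 0) in
  let v := coefs h th1 th2 th3 k m N (0, 1) in
  RtoC 2 = (t * (fst u + snd v, snd u - fst v)%R)%C.
Proof.
  intros HD m u v.
  destruct (vertex_resonator N ltac:(lia))
      as (z1 & z2 & z3 & d1 & d2 & d3 & T1 & T2 & HI & HR).
  destruct (vertex_right N _ z2 d2 ltac:(lia) outgoing_coefs T2) as [E2 E3].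
  destruct (vertex_right N _ z2 d2 ltac:(lia) (transfer N HD (le_n N)) T2) as [F2 F3].
  fold m in F2, F3. fold u in F2, F3. fold v in F2, F3.
  rewrite E2 in F2. rewrite E3 in F3. apply RtoC_mult_reg_l in F3; [|lra].
  destruct (wave_coefs_eq _ _ _ _ _ _ F2 F3) as [G1 G2].
  assert (HW : wronskian u v = 1).
  { unfold u, v. rewrite wronskian_coefs by assumption. unfold wronskian; simpl; ring. }
  destruct (proj1 (mix_outgoing u v (1 + r) (1 - r) t HW)%C) as [A1 A2].
  { symmetry. now apply injective_projections. }
  transitivity ((1 + r) + (1 - r))%C.
  - apply injective_projections; simpl; ring.
  - rewrite A1, A2. apply injective_projections; simpl; ring.
Qed.

(** At a pole the resonator function vanishes at the vertex, hence so does the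
    outgoing wave, whose modulus is constant. *)
Lemma amplitude_pole : res_value k l a b = 0 -> res_slope k l a b <> 0 -> t = RtoC 0.
Proof.
  intros HD HE.
  destruct (vertex_resonator N ltac:(lia))
      as (z1 & z2 & z3 & d1 & d2 & d3 & T1 & T2 & HI & HR).
  destruct (vertex_right N _ z2 d2 ltac:(lia) outgoing_coefs T2) as [E2 _].
  assert (Z3 : z3 = RtoC 0).
  { transitivity (RtoC k * RtoC (res_slope k l a b) * z3 / (RtoC k * RtoC (res_slope k l a b)))%C.
    { field. split; apply RtoC_neq; lra. }
    rewrite <- HR, HD. field. split; apply RtoC_neq; lra. }
  subst z3. rewrite (typeI_pole _ _ _ _ _ _ _ _ H2 H3 HI) in E2.
  transitivity (t * expi (k * x_vertex h N) * expi (- (k * x_vertex h N)))%C.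
  { unfold expi. rewrite cos_neg, sin_neg.
    transitivity (t * RtoC 1)%C; [ring|]. rewrite <- (cos2_sin2_C (k * x_vertex h N)).
    apply injective_projections; simpl; ring. }
  replace (t * expi (k * x_vertex h N))%C with (RtoC 0); [ring|].
  rewrite E2. unfold wave_of; simpl. unfold wave, expi.
  apply injective_projections; simpl; ring.
Qed.

End Amplitude.

(** * Existence *)

Fixpoint glued (h : R) (W : nat -> R -> C) (n : nat) (x : R) : C :=
  match n with
  | O => W O x
  | S n' => if Rle_dec x (x_vertex h n) then glued h W n' x else W n x
  end.

Lemma glued_segment (h : R) (W : nat -> R -> C) (n j : nat) (x : R) :
  0 < h -> (j <= n)%nat -> segment n h j x -> glued h W n x = W j x.
Proof.
  intros Hh. induction n as [|n IH]; intros Hj [Hx1 Hx2].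
  - now replace j with O by lia.
  - simpl glued. destruct (Nat.eq_dec j (S n)) as [->|Hjn].
    + specialize (Hx1 ltac:(lia)). destruct Rle_dec; [lra|reflexivity].
    + specialize (Hx2 ltac:(lia)).
      generalize (x_vertex_le h (S j) (S n) Hh ltac:(lia)). intros Hle.
      destruct Rle_dec; [|lra].
      apply IH; [lia|]. split; auto.
Qed.

(** Off the vertices a glued function agrees near [x] with one piece; [j] does not
    depend on the family [W], so [psi] and its derivative can be glued alike. *)
Lemma glued_local (h : R) (n : nat) (x : R) :
  (forall j, (1 <= j <= n)%nat -> x <> x_vertex h j) ->
  exists j, forall W : nat -> R -> C, locally x (fun y => W j y = glued h W n y).
Proof.
  induction n as [|n IH]; intros Hx.
  - exists O. intros W. now apply filter_forall.
  - specialize (Hx (S n) ltac:(lia)) as Hn.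
    destruct (Rle_dec x (x_vertex h (S n))) as [Hle|Hlt].
    + destruct IH as [j Hj]; [intros i Hi; apply Hx; lia|].
      exists j. intros W.
      generalize (filter_and _ _ (Hj W) (open_lt (x_vertex h (S n)) x ltac:(lra))).
      apply filter_imp. intros y [Hy1 Hy2]. simpl glued.
      destruct Rle_dec; [exact Hy1|lra].
    + exists (S n). intros W.
      generalize (open_gt (x_vertex h (S n)) x ltac:(lra)).
      apply filter_imp. intros y Hy. simpl glued.
      destruct Rle_dec; [lra|reflexivity].
Qed.

(** Waves [c j] on the segments and multiples [g j] of the resonator function form
    a scattering solution as soon as they match at the vertices; the endpoint
    conditions hold by the choice of the resonator function. *)
Lemma glued_solution (N : nat) (h l th1 th2 th3 a b k : R)
    (c : nat -> C * C) (g : nat -> C) (r t : C) :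
  0 < h -> 0 < l -> 0 < k -> (1 <= N)%nat ->
  c O = (1 + r, Ci * (1 - r))%C -> c N = (t, Ci * t)%C ->
  (forall j, (j < N)%nat ->
     let x := x_vertex h (S j) in
     typeI th1 th2 th3
       (wave_of k (c j) x) (wave_of k (c (S j)) x) (g (S j) * RtoC (res_value k l a b))%C
       (- (RtoC k * slope_of k (c j) x))%C (RtoC k * slope_of k (c (S j)) x)%C
       (RtoC k * (g (S j) * RtoC (res_slope k l a b)))%C) ->
  scattering_solution N h l th1 th2 th3 (robin a b) k
    (glued h (fun j => wave_of k (c j)) N)
    (fun j => wave k (g j * RtoC (res_value k l a b)) (g j * RtoC (res_slope k l a b)))%C
    r t.
Proof.
  intros Hh Hl Hk HN H0 HNt HI. split.
  - exists (glued h (fun j x => RtoC k * wave k (snd (c j)) (- fst (c j)) x)%C N).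
    intros x Hx. destruct (glued_local h N x Hx) as [j Hj].
    destruct (wave_helmholtz k (fst (c j)) (snd (c j)) x) as [D1 D2].
    split.
    + rewrite <- (locally_singleton _ _ (Hj _)).
      apply is_derive_ext_loc with (2 := D1). apply (Hj (fun j => wave_of k (c j))).
    + rewrite <- (locally_singleton _ _ (Hj (fun j => wave_of k (c j)))).
      apply is_derive_ext_loc with (2 := D2).
      apply (Hj (fun j x => RtoC k * wave k (snd (c j)) (- fst (c j)) x)%C).
  - intros j Hj.
    exists (fun s => RtoC k * wave k (g j * RtoC (res_slope k l a b))
                               (- (g j * RtoC (res_value k l a b))) s)%C.
    intros s _. apply wave_helmholtz.
  - intros [|j] Hj; [lia|]. do 6 eexists.
    split; [|split; [|split; [|exact (HI j ltac:(lia))]]].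
    + eapply trace_ext with (1 := Hh); [|apply wave_trace_left].
      intros s Hs. symmetry. apply (glued_segment h (fun j => wave_of k (c j))); [lra|lia|].
      split; intros _; rewrite ?x_vertex_S; lra.
    + eapply trace_ext with (1 := Hh); [|apply wave_trace_right].
      intros s Hs. symmetry. apply (glued_segment h (fun j => wave_of k (c j))); [lra|lia|].
      split; intros _; rewrite ?x_vertex_S; lra.
    + set (Y := (g (S j) * RtoC (res_value k l a b))%C).
      set (Q := (g (S j) * RtoC (res_slope k l a b))%C).
      generalize (wave_trace_right k Y Q 0). unfold wave at 2 3.
      rewrite Rmult_0_r, cos_0, sin_0.
      replace (Y * RtoC 1 + Q * RtoC 0)%C with Y by ring.
      replace (Q * RtoC 1 + - Y * RtoC 0)%C with Q by ring.
      apply trace_ext with 1; [lra|]. intros s _. now rewrite Rplus_0_l.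
  - intros j Hj. eexists. eexists. split; [apply wave_trace_left|].
    unfold robin, wave.
    set (s := RtoC (sin (k * l))). set (co := RtoC (cos (k * l))).
    assert (HD : RtoC (res_value k l a b) = (RtoC b * co + RtoC a / RtoC k * s)%C).
    { unfold res_value, co, s. rewrite RtoC_plus, !RtoC_mult, RtoC_div by lra. reflexivity. }
    assert (HE : RtoC (res_slope k l a b) = (RtoC b * s - RtoC a / RtoC k * co)%C).
    { unfold res_slope, co, s. rewrite RtoC_minus, !RtoC_mult, RtoC_div by lra. reflexivity. }
    rewrite HD, HE. field. apply RtoC_neq; lra.
  - intros x Hx. rewrite (glued_segment h _ N O x Hh ltac:(lia)).
    + unfold wave_of. rewrite H0. simpl. rewrite <- expi_wave. ring.
    + split; [lia|]. now rewrite x_vertex_1.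
  - intros x Hx. rewrite (glued_segment h _ N N x Hh (le_n N)).
    + unfold wave_of. rewrite HNt. simpl.
      transitivity (t * expi (k * x) + 0 * expi (- (k * x)))%C; [|ring].
      rewrite expi_wave. f_equal; ring.
    + split; [auto|lia].
Qed.

(** Cramer's rule prescribes [t], then [r]; the transfer through the vertices
    defines the waves, and [z3 / th3 = z1 / th1] the multiple of the resonator
    function.  The denominator [w] is nonzero because [u1 v2 - u2 v1 = 1] excludes
    [v2 = - u1], [v1 = u2]. *)
Lemma existence_regular (N : nat) (h l th1 th2 th3 a b k : R) :
  (1 <= N)%nat -> 0 < h -> 0 < l -> 0 < th1 -> 0 < th2 -> 0 < th3 -> 0 < k ->
  res_value k l a b <> 0 ->
  exists t psi chi r, scattering_solution N h l th1 th2 th3 (robin a b) k psi chi r t.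
Proof.
  intros HN Hh Hl H1 H2 H3 Hk HD.
  set (m := res_slope k l a b / res_value k l a b).
  set (u := fun j => coefs h th1 th2 th3 k m j (1, 0)).
  set (v := fun j => coefs h th1 th2 th3 k m j (0, 1)).
  assert (HW : wronskian (u N) (v N) = 1).
  { unfold u, v. rewrite wronskian_coefs by assumption. unfold wronskian; simpl; ring. }
  set (w := (fst (u N) + snd (v N), snd (u N) - fst (v N)) : C).
  assert (Hw : w <> RtoC 0).
  { intros E. injection E as E1 E2. unfold wronskian in HW. nra. }
  set (t := (RtoC 2 / w)%C).
  set (r := (t * (snd (v N), - fst (v N))%R - 1)%C).
  assert (Hc : mix (1 + r) (Ci * (1 - r)) (u N) (v N) = (t, Ci * t)%C).
  { apply (mix_outgoing _ _ _ _ t HW). split.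
    - unfold r. ring.
    - transitivity (t * w - t * (snd (v N), - fst (v N))%R)%C.
      + unfold r. replace (t * w)%C with (RtoC 2) by (unfold t; field; exact Hw).
        apply injective_projections; simpl; ring.
      + unfold w. apply injective_projections; simpl; ring. }
  set (c := fun j => mix (1 + r) (Ci * (1 - r)) (u j) (v j)).
  set (g := fun j => (RtoC (th3 / th1 / res_value k l a b) *
                      wave_of k (c (pred j)) (x_vertex h j))%C).
  exists t. do 2 eexists. exists r.
  apply glued_solution with (c := c) (g := g); auto.
  { unfold c, u, v, mix; simpl. f_equal; ring. }
  intros j Hj x. unfold g. simpl pred. fold x.
  assert (E1 : wave_of k (c (S j)) x = (RtoC (th2 / th1) * wave_of k (c j) x)%C).
  { apply wave_mix_jump. }
  assert (E2 : slope_of k (c (S j)) x = (RtoC (th1 / th2) * slope_of k (c j) x -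
       RtoC (th3 ^ 2 / (th1 * th2) * m) * wave_of k (c j) x)%C).
  { apply slope_mix_jump. }
  rewrite E1, E2. generalize (wave_of k (c j) x) (slope_of k (c j) x). intros z p.
  assert (C1 : RtoC th1 <> RtoC 0) by (apply RtoC_neq; lra).
  assert (C2 : RtoC th2 <> RtoC 0) by (apply RtoC_neq; lra).
  assert (C3 : RtoC th3 <> RtoC 0) by (apply RtoC_neq; lra).
  assert (CD : RtoC (res_value k l a b) <> RtoC 0) by (apply RtoC_neq; lra).
  assert (Hn : th1 * th2 <> 0) by nra.
  unfold m, Rdiv. simpl pow. rewrite !RtoC_mult, !RtoC_inv by lra. rewrite !RtoC_mult.
  repeat split; field; auto.
Qed.

(** Total reflection: [psi = 2 i sin kx] on the incoming lead and [0] beyond the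
    first vertex, whose resonator absorbs the jump of the derivative. *)
Lemma existence_pole (N : nat) (h l th1 th2 th3 a b k : R) :
  (1 <= N)%nat -> 0 < h -> 0 < l -> 0 < th1 -> 0 < th2 -> 0 < th3 -> 0 < k ->
  res_value k l a b = 0 -> res_slope k l a b <> 0 ->
  exists t psi chi r, scattering_solution N h l th1 th2 th3 (robin a b) k psi chi r t.
Proof.
  intros HN Hh Hl H1 H2 H3 Hk HD HE.
  exists (RtoC 0). do 2 eexists. exists (- RtoC 1)%C.
  apply glued_solution with
    (c := fun j => match j with O => (RtoC 0, 2 * Ci)%C | _ => (RtoC 0, RtoC 0) end)
    (g := fun j => match j with
                   | 1%nat => (2 * Ci * RtoC th1 / (RtoC th3 * RtoC (res_slope k l a b)))%C
                   | _ => RtoC 0 end); auto.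
  { f_equal; ring. }
  { destruct N; [lia|]. f_equal; ring. }
  assert (C1 : RtoC th1 <> RtoC 0) by (apply RtoC_neq; lra).
  assert (C2 : RtoC th2 <> RtoC 0) by (apply RtoC_neq; lra).
  assert (C3 : RtoC th3 <> RtoC 0) by (apply RtoC_neq; lra).
  assert (CE : RtoC (res_slope k l a b) <> RtoC 0) by (apply RtoC_neq; lra).
  intros [|j] Hj x; unfold x, wave_of, slope_of, wave; simpl fst; simpl snd.
  - rewrite x_vertex_1, HD, Rmult_0_r, cos_0, sin_0.
    repeat split; field; auto.
  - repeat split; field; auto.
Qed.

(** * Transmission probability *)

(** The energy [chi^2 + (chi' / k)^2] is the same at both ends of the resonator. *)
Lemma res_value_slope (k l a b : R) :
  res_value k l a b ^ 2 + res_slope k l a b ^ 2 = b ^ 2 + (a / k) ^ 2.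
Proof.
  unfold res_value, res_slope.
  transitivity ((b ^ 2 + (a / k) ^ 2) * 1); [|ring].
  rewrite <- (cos2_sin2 (k * l)). ring.
Qed.

Definition transmittance (N : nat) (h th1 th2 th3 k m : R) : R :=
  let u := coefs h th1 th2 th3 k m N (1, 0) in
  let v := coefs h th1 th2 th3 k m N (0, 1) in
  4 / (fst u ^ 2 + snd u ^ 2 + fst v ^ 2 + snd v ^ 2 + 2).

(** [|2|^2 = |t|^2 ((u1 + v2)^2 + (u2 - v1)^2)], and expanding the squares leaves
    the cross term [2 (u1 v2 - u2 v1) = 2]. *)
Lemma probability_regular (N : nat) (h l th1 th2 th3 a b k : R) :
  (1 <= N)%nat -> 0 < h -> 0 < l -> 0 < th1 -> 0 < th2 -> 0 < th3 -> 0 < k ->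
  res_value k l a b <> 0 ->
  transmission_probability N h l th1 th2 th3 (robin a b) k =
  transmittance N h th1 th2 th3 k (res_slope k l a b / res_value k l a b).
Proof.
  intros HN Hh Hl H1 H2 H3 Hk HD.
  unfold transmission_probability, transmission_amplitude.
  destruct (epsilon_spec (inhabits (RtoC 0)) _
              (existence_regular N h l th1 th2 th3 a b k HN Hh Hl H1 H2 H3 Hk HD))
    as (psi & chi & r & Hs).
  set (t := epsilon _ _) in *.
  generalize (amplitude_regular _ _ _ _ _ _ _ _ _ _ _ _ _ HN Hh Hl H1 H2 H3 Hk Hs HD).
  intros E. cbv zeta in E. unfold transmittance.
  set (m := res_slope k l a b / res_value k l a b) in *.
  set (u := coefs h th1 th2 th3 k m N (1, 0)) in *.
  set (v := coefs h th1 th2 th3 k m N (0, 1)) in *.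
  assert (HW : wronskian u v = 1).
  { unfold u, v. rewrite wronskian_coefs by assumption. unfold wronskian; simpl; ring. }
  apply (f_equal (fun z => Cmod z ^ 2)) in E.
  rewrite Cmod_mult, Rpow_mult_distr, !Cmod2_alt in E. rewrite Cmod2_alt.
  simpl Re in E. simpl Im in E. unfold wronskian in HW.
  set (T := Re t ^ 2 + Im t ^ 2) in *.
  assert (HS : (fst u + snd v) ^ 2 + (snd u - fst v) ^ 2 =
               fst u ^ 2 + snd u ^ 2 + fst v ^ 2 + snd v ^ 2 + 2).
  { transitivity (fst u ^ 2 + snd u ^ 2 + fst v ^ 2 + snd v ^ 2
                  + 2 * (fst u * snd v - snd u * fst v)); [ring|]. rewrite HW. ring. }
  rewrite HS in E.
  assert (HP : 0 < fst u ^ 2 + snd u ^ 2 + fst v ^ 2 + snd v ^ 2 + 2).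
  { generalize (pow2_ge_0 (fst u)) (pow2_ge_0 (snd u)) (pow2_ge_0 (fst v)) (pow2_ge_0 (snd v)). lra. }
  apply (Rmult_eq_reg_r (fst u ^ 2 + snd u ^ 2 + fst v ^ 2 + snd v ^ 2 + 2)); [|lra].
  rewrite <- E. field. lra.
Qed.

Lemma probability_pole (N : nat) (h l th1 th2 th3 a b k : R) :
  (1 <= N)%nat -> 0 < h -> 0 < l -> 0 < th1 -> 0 < th2 -> 0 < th3 -> 0 < k ->
  res_value k l a b = 0 -> b <> 0 ->
  transmission_probability N h l th1 th2 th3 (robin a b) k = 0.
Proof.
  intros HN Hh Hl H1 H2 H3 Hk HD Hb.
  assert (HE : res_slope k l a b <> 0).
  { intros HE. generalize (res_value_slope k l a b). rewrite HD, HE.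
    generalize (pow2_gt_0 b Hb) (pow2_ge_0 (a / k)). lra. }
  unfold transmission_probability, transmission_amplitude.
  destruct (epsilon_spec (inhabits (RtoC 0)) _
              (existence_pole N h l th1 th2 th3 a b k HN Hh Hl H1 H2 H3 Hk HD HE))
    as (psi & chi & r & Hs).
  rewrite (amplitude_pole _ _ _ _ _ _ _ _ _ _ _ _ _ HN Hh Hl H2 H3 Hk Hs HD HE).
  rewrite Cmod_0. ring.
Qed.

Lemma transmittance_bounds (N : nat) (h th1 th2 th3 k m : R) :
  0 <= transmittance N h th1 th2 th3 k m <= 2.
Proof.
  unfold transmittance. set (u := coefs _ _ _ _ _ _ _ _). set (v := coefs _ _ _ _ _ _ _ _).
  generalize (pow2_ge_0 (fst u)) (pow2_ge_0 (snd u)) (pow2_ge_0 (fst v)) (pow2_ge_0 (snd v)).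
  intros A B C D. split.
  - apply Rle_mult_inv_pos; lra.
  - apply Rle_div_l; lra.
Qed.

Lemma probability_bounds (N : nat) (h l th1 th2 th3 a b k : R) :
  (1 <= N)%nat -> 0 < h -> 0 < l -> 0 < th1 -> 0 < th2 -> 0 < th3 -> 0 < k -> b <> 0 ->
  0 <= transmission_probability N h l th1 th2 th3 (robin a b) k <= 2.
Proof.
  intros HN Hh Hl H1 H2 H3 Hk Hb.
  destruct (Req_dec (res_value k l a b) 0) as [HD|HD].
  - rewrite probability_pole; auto; lra.
  - rewrite probability_regular; auto. apply transmittance_bounds.
Qed.

(** * Lipschitz dependence on the resonator impedance *)

(** Bounded and Lipschitz in [m] for [m] in a bounded set, uniformly in [k].
    Such functions form an algebra. *)
Definition tame (f : R -> R -> R) : Prop :=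
  forall B, 0 <= B -> exists L, 0 <= L /\ forall k m m',
    Rabs m <= B -> Rabs m' <= B ->
    Rabs (f k m) <= L /\ Rabs (f k m - f k m') <= L * Rabs (m - m').

Lemma tame_free (f : R -> R) (L : R) :
  (forall k, Rabs (f k) <= L) -> tame (fun k _ => f k).
Proof.
  intros Hf B HB. exists L.
  assert (HL : 0 <= L) by (apply Rle_trans with (2 := Hf 0), Rabs_pos).
  split; [exact HL|]. intros k m m' _ _. split; [apply Hf|].
  rewrite Rminus_diag, Rabs_R0. apply Rmult_le_pos; [exact HL|apply Rabs_pos].
Qed.

Lemma tame_const (c : R) : tame (fun _ _ => c).
Proof. apply (tame_free (fun _ => c) (Rabs c)). intros _. apply Rle_refl. Qed.

Lemma tame_cos (x : R) : tame (fun k _ => cos (k * x)).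
Proof.
  apply (tame_free (fun k => cos (k * x)) 1). intros k.
  apply Rabs_le. generalize (COS_bound (k * x)). lra.
Qed.

Lemma tame_sin (x : R) : tame (fun k _ => sin (k * x)).
Proof.
  apply (tame_free (fun k => sin (k * x)) 1). intros k.
  apply Rabs_le. generalize (SIN_bound (k * x)). lra.
Qed.

Lemma tame_impedance : tame (fun _ m => m).
Proof.
  intros B HB. exists (B + 1). split; [lra|]. intros k m m' Hm Hm'. split; [lra|].
  generalize (Rabs_pos (m - m')). nra.
Qed.

Lemma tame_plus (f g : R -> R -> R) :
  tame f -> tame g -> tame (fun k m => f k m + g k m).
Proof.
  intros Hf Hg B HB. destruct (Hf B HB) as (L & HL & Hf').
  destruct (Hg B HB) as (M & HM & Hg'). exists (L + M). split; [lra|].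
  intros k m m' Hm Hm'. destruct (Hf' k m m' Hm Hm') as [F1 F2].
  destruct (Hg' k m m' Hm Hm') as [G1 G2]. split.
  - apply Rle_trans with (1 := Rabs_triang _ _). lra.
  - replace (f k m + g k m - (f k m' + g k m'))
      with ((f k m - f k m') + (g k m - g k m')) by ring.
    apply Rle_trans with (1 := Rabs_triang _ _). lra.
Qed.

Lemma tame_mult (f g : R -> R -> R) :
  tame f -> tame g -> tame (fun k m => f k m * g k m).
Proof.
  intros Hf Hg B HB. destruct (Hf B HB) as (L & HL & Hf').
  destruct (Hg B HB) as (M & HM & Hg'). exists (2 * L * M).
  assert (HLM : 0 <= L * M) by now apply Rmult_le_pos.
  split; [lra|].
  intros k m m' Hm Hm'. destruct (Hf' k m m' Hm Hm') as [F1 F2].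
  destruct (Hg' k m m' Hm Hm') as [G1 G2].
  destruct (Hg' k m' m Hm' Hm) as [G1' _]. split.
  - rewrite Rabs_mult. apply Rle_trans with (L * M); [|lra].
    apply Rmult_le_compat; auto using Rabs_pos.
  - replace (f k m * g k m - f k m' * g k m')
      with (f k m * (g k m - g k m') + (f k m - f k m') * g k m') by ring.
    apply Rle_trans with (1 := Rabs_triang _ _). rewrite !Rabs_mult.
    replace (2 * L * M * Rabs (m - m'))
      with (L * (M * Rabs (m - m')) + L * Rabs (m - m') * M) by ring.
    apply Rplus_le_compat; apply Rmult_le_compat; auto using Rabs_pos.
Qed.

Lemma tame_ext (f g : R -> R -> R) :
  (forall k m, f k m = g k m) -> tame f -> tame g.
Proof.
  intros E Hf B HB. destruct (Hf B HB) as (L & HL & Hf'). exists L. split; [exact HL|].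
  intros k m m'. rewrite <- !E. apply Hf'.
Qed.

Lemma tame_coefs (h th1 th2 th3 : R) (n : nat) (v : R * R) :
  tame (fun k m => fst (coefs h th1 th2 th3 k m n v)) /\
  tame (fun k m => snd (coefs h th1 th2 th3 k m n v)).
Proof.
  induction n as [|n [IH1 IH2]].
  { split; [exact (tame_const (fst v))|exact (tame_const (snd v))]. }
  set (x := x_vertex h (S n)).
  set (w := fun k m => coefs h th1 th2 th3 k m n v) in *.
  assert (HV : tame (fun k m => value k x (w k m))).
  { unfold value. apply tame_plus; apply tame_mult; auto using tame_cos, tame_sin. }
  assert (HS : tame (fun k m => slope k x (w k m))).
  { apply tame_ext with (fun k m => snd (w k m) * cos (k * x) + (-1) * (fst (w k m) * sin (k * x))).
    { intros k m. unfold slope. ring. }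
    apply tame_plus; repeat apply tame_mult; auto using tame_cos, tame_sin, tame_const. }
  assert (HZ : tame (fun k m => th2 / th1 * value k x (w k m))).
  { apply tame_mult; auto using tame_const. }
  assert (HP : tame (fun k m => th1 / th2 * slope k x (w k m) -
                       th3 ^ 2 / (th1 * th2) * m * value k x (w k m))).
  { apply tame_ext with (fun k m => th1 / th2 * slope k x (w k m) +
                       - (th3 ^ 2 / (th1 * th2)) * m * value k x (w k m)).
    { intros k m. ring. }
    apply tame_plus; repeat apply tame_mult; auto using tame_const, tame_impedance. }
  split.
  - eapply tame_ext; [|exact (tame_plus _ _ (tame_mult _ _ HZ (tame_cos x))
        (tame_mult _ _ (tame_const (-1)) (tame_mult _ _ HP (tame_sin x))))].
    intros k m. unfold w, x. simpl. ring.
  - exact (tame_plus _ _ (tame_mult _ _ HZ (tame_sin x)) (tame_mult _ _ HP (tame_cos x))).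
Qed.

(** For [X, Y >= 0], the map [X |-> 4 / (X + 2)] does not increase distances. *)
Lemma transmittance_lipschitz (N : nat) (h th1 th2 th3 B : R) :
  0 <= B -> exists L, 0 <= L /\ forall k m m', Rabs m <= B -> Rabs m' <= B ->
    Rabs (transmittance N h th1 th2 th3 k m - transmittance N h th1 th2 th3 k m') <=
    L * Rabs (m - m').
Proof.
  intros HB.
  assert (Hsq : forall f, tame f -> tame (fun k m => f k m ^ 2)).
  { intros f Hf. apply tame_ext with (2 := tame_mult _ _ Hf Hf). intros; ring. }
  destruct (tame_coefs h th1 th2 th3 N (1, 0)) as [U1 U2].
  destruct (tame_coefs h th1 th2 th3 N (0, 1)) as [V1 V2].
  destruct (tame_plus _ _ (tame_plus _ _ (tame_plus _ _ (Hsq _ U1) (Hsq _ U2)) (Hsq _ V1))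
              (Hsq _ V2) B HB) as (L & HL & HLip).
  exists L. split; [exact HL|]. intros k m m' Hm Hm'.
  destruct (HLip k m m' Hm Hm') as [_ H]. apply Rle_trans with (2 := H). clear H.
  assert (Hpos : forall u v : R * R, 0 <= fst u ^ 2 + snd u ^ 2 + fst v ^ 2 + snd v ^ 2).
  { intros u v. generalize (pow2_ge_0 (fst u)) (pow2_ge_0 (snd u)) (pow2_ge_0 (fst v)) (pow2_ge_0 (snd v)). lra. }
  unfold transmittance.
  generalize (Hpos (coefs h th1 th2 th3 k m N (1, 0)) (coefs h th1 th2 th3 k m N (0, 1))).
  generalize (Hpos (coefs h th1 th2 th3 k m' N (1, 0)) (coefs h th1 th2 th3 k m' N (0, 1))).
  set (X := _ + _ + _ + _). intros HX. set (Y := _ + _ + _ + _). intros HY.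
  replace (4 / (Y + 2) - 4 / (X + 2)) with (4 / ((X + 2) * (Y + 2)) * (X - Y)) by (field; lra).
  rewrite Rabs_mult, (Rabs_minus_sym X Y).
  transitivity (1 * Rabs (Y - X)); [|lra].
  apply Rmult_le_compat_r; [apply Rabs_pos|].
  assert (4 <= (X + 2) * (Y + 2)) by nra.
  rewrite Rabs_pos_eq by (apply Rle_mult_inv_pos; lra).
  apply Rle_div_l; lra.
Qed.

(** * Away from the anti-resonances *)

(** Each [k > 0] lies within [PI / (2 l)] of the nearest [kappa l n], and there
    [|cos kl| = sin (l |k - kappa l n|)].  The minimum with [PI / 2] keeps the
    bound positive when [rho] is so large that no such [k] exists. *)
Lemma cos_away (l rho : R) :
  0 < l -> 0 < rho -> exists del, 0 < del <= 1 /\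
  forall k, 0 < k -> (forall n, (1 <= n)%nat -> rho <= Rabs (k - kappa l n)) ->
  del <= Rabs (cos (k * l)).
Proof.
  intros Hl Hr.
  assert (HPI := PI_RGT_0).
  assert (Hrl : 0 < rho * l) by now apply Rmult_lt_0_compat.
  set (q := Rmin (rho * l) (PI / 2)).
  assert (Hq : 0 < q <= PI / 2).
  { unfold q. split; [apply Rmin_glb_lt; lra|apply Rmin_r]. }
  exists (sin q). split.
  { split; [apply sin_gt_0; lra|apply SIN_bound]. }
  intros k Hk Hn.
  (* The nearest anti-resonance has index [floor (kl / PI) + 1]. *)
  destruct (nfloor_ex (k * l / PI)) as [n [Hn1 Hn2]].
  { apply Rle_mult_inv_pos; [|lra]. apply Rlt_le. now apply Rmult_lt_0_compat. }
  specialize (Hn (S n) ltac:(lia)).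
  set (y := k * l - (2 * INR (S n) - 1) * PI / 2).
  assert (Hy : Rabs y <= PI / 2).
  { apply Rle_div_r in Hn1; [|lra].
    assert (Hn2' : k * l < (INR n + 1) * PI) by (apply Rlt_div_l; lra).
    unfold y. rewrite S_INR. apply Rabs_le. lra. }
  assert (Hy' : rho * l <= Rabs y).
  { replace y with ((k - kappa l (S n)) * l) by (unfold y, kappa; field; lra).
    rewrite Rabs_mult, (Rabs_pos_eq l) by lra.
    apply Rmult_le_compat_r; lra. }
  assert (Hcos : Rabs (cos (k * l)) = Rabs (sin y)).
  { replace (k * l) with (y + PI / 2 + INR n * PI)
      by (unfold y; rewrite S_INR; field).
    assert (Hper : forall x, Rabs (cos (x + INR n * PI)) = Rabs (cos x)).
    { clear. intros x. induction n as [|n IH].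
      - simpl. now rewrite Rmult_0_l, Rplus_0_r.
      - rewrite S_INR. replace (x + (INR n + 1) * PI) with (x + INR n * PI + PI) by ring.
        rewrite neg_cos, Rabs_Ropp. exact IH. }
    rewrite Hper. rewrite cos_plus, cos_PI2, sin_PI2.
    replace (cos y * 0 - sin y * 1) with (- sin y) by ring. apply Rabs_Ropp. }
  rewrite Hcos.
  assert (Hsin : Rabs (sin y) = sin (Rabs y)).
  { unfold Rabs at 2. destruct (Rcase_abs y) as [Hy0|Hy0].
    - rewrite sin_neg. apply Rabs_left1.
      apply Rabs_le_between in Hy. assert (0 <= sin (- y)) by (apply sin_ge_0; lra).
      rewrite sin_neg in H. lra.
    - apply Rabs_pos_eq. apply Rabs_le_between in Hy. apply sin_ge_0; lra. }
  rewrite Hsin. apply sin_incr_1; try lra.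
  unfold q. apply Rle_trans with (1 := Rmin_l _ _). exact Hy'.
Qed.

(** With [e = a / (b k)] the Robin impedance is [(s - e c) / (c + e s)], and it
    differs from [s / c] by [- e / (c (c + e s))]. *)
Lemma impedance_close (k l a b del : R) :
  0 < k -> b <> 0 -> 0 < del <= 1 -> del <= Rabs (cos (k * l)) ->
  Rabs (a / b / k) <= del / 2 ->
  res_value k l a b <> 0 /\ res_value k l 0 1 <> 0 /\
  Rabs (res_slope k l 0 1 / res_value k l 0 1) <= 4 / del /\
  Rabs (res_slope k l a b / res_value k l a b) <= 4 / del /\
  Rabs (res_slope k l a b / res_value k l a b -
        res_slope k l 0 1 / res_value k l 0 1) <= 2 / del ^ 2 * Rabs (a / b / k).
Proof.
  intros Hk Hb Hdel Hc He.
  set (e := a / b / k) in *. set (c := cos (k * l)) in *. set (s := sin (k * l)).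
  assert (V : res_value k l a b = b * (c + e * s)).
  { unfold res_value, e, c, s. field; lra. }
  assert (E : res_slope k l a b = b * (s - e * c)).
  { unfold res_slope, e, c, s. field; lra. }
  assert (V0 : res_value k l 0 1 = c) by (unfold res_value, c; field; lra).
  assert (E0 : res_slope k l 0 1 = s) by (unfold res_slope, s; field; lra).
  assert (Hs1 : Rabs s <= 1).
  { apply Rabs_le. generalize (SIN_bound (k * l)). fold s. lra. }
  assert (Hc1 : Rabs c <= 1).
  { apply Rabs_le. generalize (COS_bound (k * l)). fold c. lra. }
  assert (Hes : Rabs (e * s) <= del / 2).
  { rewrite Rabs_mult. generalize (Rabs_pos e) (Rabs_pos s). nra. }
  assert (Hec : Rabs (e * c) <= del / 2).
  { rewrite Rabs_mult. generalize (Rabs_pos e) (Rabs_pos c). nra. }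
  assert (Hd : del / 2 <= Rabs (c + e * s)).
  { generalize (Rabs_triang (c + e * s) (- (e * s))). rewrite Rabs_Ropp.
    replace (c + e * s + - (e * s)) with c by ring. lra. }
  assert (Hc0 : c <> 0) by (intros Z; rewrite Z, Rabs_R0 in Hc; lra).
  assert (Hd0 : c + e * s <> 0) by (intros Z; rewrite Z, Rabs_R0 in Hd; lra).
  assert (Hce : s ^ 2 + c ^ 2 = 1).
  { unfold s, c. rewrite <- !Rsqr_pow2. apply sin2_cos2. }
  rewrite V, E, V0, E0.
  split; [now apply Rmult_integral_contrapositive|]. split; [exact Hc0|].
  replace (b * (s - e * c) / (b * (c + e * s))) with ((s - e * c) / (c + e * s))
    by (field; auto).
  assert (Hq : forall num den d, 0 < d -> d <= Rabs den -> Rabs num <= 2 ->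
            Rabs (num / den) <= 2 / d).
  { intros num den d Hd1 Hd2 Hnum. rewrite Rabs_div by (intros Z; rewrite Z, Rabs_R0 in Hd2; lra).
    apply Rmult_le_compat; [apply Rabs_pos| |exact Hnum|].
    - apply Rlt_le, Rinv_0_lt_compat. lra.
    - apply Rinv_le_contravar; lra. }
  replace (4 / del) with (2 / (del / 2)) by (field; lra).
  split; [apply Hq; lra|]. split.
  { apply Hq; [lra|exact Hd|]. unfold Rminus.
    apply Rle_trans with (1 := Rabs_triang _ _). rewrite Rabs_Ropp. lra. }
  replace ((s - e * c) / (c + e * s) - s / c) with (- e / (c * (c + e * s))).
  2:{ transitivity (- e * (s ^ 2 + c ^ 2) / (c * (c + e * s))); [rewrite Hce|]; field; auto. }
  assert (Hcd : del * (del / 2) <= Rabs (c * (c + e * s))).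
  { rewrite Rabs_mult. apply Rmult_le_compat; lra. }
  assert (0 < del * (del / 2)) by nra.
  rewrite Rabs_div by now apply Rmult_integral_contrapositive.
  rewrite Rabs_Ropp.
  replace (2 / del ^ 2 * Rabs e) with (Rabs e * / (del * (del / 2))) by (field; lra).
  apply Rmult_le_compat_l; [apply Rabs_pos|]. apply Rinv_le_contravar; lra.
Qed.

Lemma neumann_robin : neumann = robin 0 1.
Proof.
  apply functional_extensionality. intros z. apply functional_extensionality. intros d.
  apply propositional_extensionality. unfold neumann, robin.
  replace (RtoC 0 * z + RtoC 1 * d)%C with d by ring. reflexivity.
Qed.

Theorem mainTheorem6 :
  forall (N : nat) (h l th1 th2 th3 alpha beta : R),
    (1 <= N)%nat -> 0 < h -> 0 < l ->
    0 < th1 -> 0 < th2 -> 0 < th3 ->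
    alpha * beta <> 0 ->
    let T_Rob := transmission_probability N h l th1 th2 th3 (robin alpha beta) in
    let T_Neu := transmission_probability N h l th1 th2 th3 neumann in
    forall rho : R, 0 < rho ->
      exists S : R -> R,
        (forall K : R,
           is_lub (values0 (admissible l rho K)
                           (fun k => Rabs (T_Rob k - T_Neu k))) (S K)) /\
        is_lim S p_infty 0.
Proof.
  intros N h l th1 th2 th3 alpha beta HN Hh Hl H1 H2 H3 Hab T_Rob T_Neu rho Hrho.
  assert (Hb : beta <> 0) by (intros Z; apply Hab; rewrite Z; ring).
  unfold T_Neu. rewrite neumann_robin. clear T_Neu.
  set (T_Neu := transmission_probability _ _ _ _ _ _ (robin 0 1)).
  set (F := fun k => Rabs (T_Rob k - T_Neu k)).
  assert (Hbound : forall K, bound (values0 (admissible l rho K) F)).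
  { intros K. exists 2. intros y [->|[k [[Hk _] ->]]]; [lra|].
    unfold F, T_Rob, T_Neu.
    generalize (probability_bounds N h l th1 th2 th3 alpha beta k HN Hh Hl H1 H2 H3 Hk Hb).
    generalize (probability_bounds N h l th1 th2 th3 0 1 k HN Hh Hl H1 H2 H3 Hk R1_neq_R0).
    intros A B. apply Rabs_le. lra. }
  assert (Hne : forall K, exists y, values0 (admissible l rho K) F y).
  { intros K. exists 0. now left. }
  exists (fun K => proj1_sig (completeness _ (Hbound K) (Hne K))).
  assert (Hlub : forall K, is_lub (values0 (admissible l rho K) F)
                  (proj1_sig (completeness _ (Hbound K) (Hne K)))).
  { intros K. apply proj2_sig. }
  split; [exact Hlub|].
  destruct (cos_away l rho Hl Hrho) as (del & Hdel & Hcos).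
  destruct (transmittance_lipschitz N h th1 th2 th3 (4 / del)) as (L & HL & HLip).
  { apply Rle_mult_inv_pos; lra. }
  set (e := Rabs (alpha / beta)). assert (He : 0 <= e) by apply Rabs_pos.
  set (M := L * (2 / del ^ 2) * e).
  assert (HM : 0 <= M).
  { unfold M. apply Rmult_le_pos; [apply Rmult_le_pos|]; auto.
    apply Rle_mult_inv_pos; [lra|]. apply pow_lt. lra. }
  apply is_lim_spec. intros eps.
  (* Beyond the first term the Robin impedance is under control, beyond the second
     one [M / k <= eps / 2]. *)
  exists (2 * e / del + M * 2 / eps + 1). intros K HK.
  assert (Heps := cond_pos eps).
  assert (P1 : 0 <= 2 * e / del) by (apply Rle_mult_inv_pos; lra).
  assert (P2 : 0 <= M * 2 / eps) by (apply Rle_mult_inv_pos; lra).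
  destruct (Hlub K) as [Hub Hleast].
  set (S := proj1_sig _) in *.
  assert (HS0 : 0 <= S) by (apply Hub; now left).
  assert (HS1 : S <= eps / 2).
  { apply Hleast. intros y [->|[k [[Hk [HKk Hn]] ->]]]; [lra|].
    assert (Hek : Rabs (alpha / beta / k) = e / k).
    { unfold Rdiv at 1. rewrite Rabs_mult, Rabs_inv, (Rabs_pos_eq k) by lra. reflexivity. }
    assert (Hsmall : Rabs (alpha / beta / k) <= del / 2).
    { rewrite Hek. apply Rle_div_l; [lra|].
      assert (2 * e / del <= k) by lra. apply Rle_div_l in H; lra. }
    destruct (impedance_close k l alpha beta del Hk Hb Hdel (Hcos k Hk Hn) Hsmall)
      as (V & V0 & B0 & B & Hdiff).
    unfold F, T_Rob, T_Neu. rewrite !probability_regular by auto.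
    apply Rle_trans with (1 := HLip k _ _ B B0).
    apply Rle_trans with (L * (2 / del ^ 2 * Rabs (alpha / beta / k))).
    { now apply Rmult_le_compat_l. }
    rewrite Hek. replace (L * (2 / del ^ 2 * (e / k))) with (M / k).
    2:{ unfold M. field. lra. }
    apply Rle_div_l; [lra|].
    assert (Hk2 : M * 2 / eps <= k) by lra. apply Rle_div_l in Hk2; lra. }
  rewrite Rminus_0_r, Rabs_pos_eq by exact HS0. lra.
Qed.
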